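(* Let $A, B \subset \mathbb{N}$ be infinite sets and let $\alpha, \beta$ be real numbers such that $s_A(x) \sim x^{\alpha}$ and $d_{A,B}(x) \sim x^{\beta}$ as $x \to \infty$. Then $$x^{\max\{0, \alpha - \beta\}} \ll s_B(x) \ll x^{\min\{\alpha+\beta, 1\}}.$$
   Context: $\mathbb{N}$ denotes the set of nonnegative integers. For infinite sets $A = \{a_1 < a_2 < \cdots\}$, $B = \{b_1 < b_2 < \cdots\}$ of nonnegative integers, enumerated increasingly: $R_A(n)$ is the number of pairs $(i,j)$ with $i \le j$ and $a_i + a_j = n$; $s_A(x) = \max_{n \le x} R_A(n)$ (similarly for $B$); $d_{A,B}(x) = \max\{|a_t - b_t| : a_t \le x \text{ or } b_t \le x\}$. $f \ll g$ means $f = O(g)$ as $x\to\infty$; $f \sim g$ means $f/g \to 1$ as $x\to\infty$. *)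

(* Defs.v *)
From mathcomp Require Import all_boot all_order all_algebra finmap.
From mathcomp Require Import all_classical all_reals all_analysis.
Import Order.TTheory GRing.Theory Num.Theory numFieldNormedType.Exports.

Set Implicit Arguments.
Unset Strict Implicit.
Unset Printing Implicit Defensive.

Local Open Scope classical_set_scope.
Local Open Scope ring_scope.

Definition increasing_enum_spec (A : set nat) (a : nat -> nat) : Prop :=
  {homo a : i j / (i < j)%N} /\ range a = A.

(* Indices start at 0, so that [enum_inc A t] is the element a_{t+1} of
   A = {a_1 < a_2 < ...}.  The default value [id] is used only when A is
   finite, see [enum_incP]. *)
Definition enum_inc (A : set nat) : nat -> nat :=
  xget (id : nat -> nat) (increasing_enum_spec A).

(* [fset_set S] is the finite set S, and the empty one if S is infinite; this
   default is never used below when A and B are infinite, see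
   [finite_rep_pairs], [finite_rep_values] and [finite_shifts]. *)

Definition rep_pairs (A : set nat) (n : nat) : set (nat * nat) :=
  [set p | (p.1 <= p.2)%N /\ (enum_inc A p.1 + enum_inc A p.2 = n)%N].

Definition rep_count (A : set nat) (n : nat) : nat :=
  #|` fset_set (rep_pairs A n)|.

(* Maximum of a finite set of natural numbers, with the convention
   max {} = 0. *)
Definition set_max (S : set nat) : nat := \max_(k <- fset_set S) k.

Definition rep_values (R : realType) (A : set nat) (x : R) : set nat :=
  [set rep_count A n | n in [set n : nat | n%:R <= x]].

Definition rep_max (R : realType) (A : set nat) (x : R) : nat :=
  set_max (rep_values A x).

Definition shifts (R : realType) (A B : set nat) (x : R) : set nat :=
  [set `|(enum_inc A t)%:Z - (enum_inc B t)%:Z|%N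
    | t in [set t | (enum_inc A t)%:R <= x \/ (enum_inc B t)%:R <= x]].

Definition enum_dist (R : realType) (A B : set nat) (x : R) : nat :=
  set_max (shifts A B x).

(* Makes [f =O_ (pinfty_nbhs R) g] well typed; see [eqO_pinftyP]. *)
Canonical pinfty_filter_on (R : numFieldType) :=
  FilterType (pinfty_nbhs R) (@filter_filter R _ proper_pinfty_nbhs).

Lemma eqO_pinftyP (R : realType) (f g : R -> R) :
  f =O_ (pinfty_nbhs R) g <->
  exists2 k, 0 < k & \forall x \near +oo, `|f x| <= k * `|g x|.
Proof. exact: eqO_exP. Qed.

Lemma increasing_enum_spec_uniq A a b :
  increasing_enum_spec A a -> increasing_enum_spec A b -> a = b.
Proof.
move=> [ha rA] [hb rB].
have key c d : {homo c : i j / (i < j)%N} -> {homo d : i j / (i < j)%N} ->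
    range c = range d -> forall n, (forall m, (m < n)%N -> c m = d m) ->
    (d n <= c n)%N.
  move=> hc hd e n IH.
  have : range d (c n) by rewrite -e; exists n.
  case=> k _ dk; rewrite -dk; case: (ltngtP k n) => [kn|nk|->] //.
    by have := hc _ _ kn; rewrite IH// dk ltnn.
  exact/ltnW/hd.
apply/funext => n; elim/ltn_ind: n => n IH; apply/eqP.
by rewrite eqn_leq !key// ?rA ?rB// => m mn; rewrite IH.
Qed.

Lemma increasing_enum_exists A :
  infinite_set A -> exists a, increasing_enum_spec A a.
Proof.
move=> infA.
have nextP m : exists n, (m <= n)%N && `[< A n >].
  apply: contrapT => none; apply: infA.
  apply: (@sub_finite_set _ _ `I_m) => [n An|]; last exact: finite_II.
  rewrite /= ltnNge; apply/negP => mn; apply: none.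
  by exists n; rewrite mn; apply/asboolP.
pose next m := ex_minn (nextP m).
have next_ge m : (m <= next m)%N by rewrite /next; case: ex_minnP => n /andP[].
have next_in m : A (next m).
  by rewrite /next; case: ex_minnP => n /andP[_ /asboolP].
have next_min m k : A k -> (m <= k)%N -> (next m <= k)%N.
  rewrite /next; case: ex_minnP => n _ h Ak mk; apply: h.
  by rewrite mk; apply/asboolP.
pose a n := iter n (fun m => next m.+1) (next 0%N).
have aS n : a n.+1 = next (a n).+1 by [].
have ha : {homo a : i j / (i < j)%N}.
  by apply: homo_ltn => [? ? ?|n]; [exact: ltn_trans | rewrite aS next_ge].
have aA n : A (a n) by case: n => [|n]; exact: next_in.
exists a; split=> //; apply/seteqP; split=> [_ [n _ <-]//|k Ak].
have a_ge n : (n <= a n)%N.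
  by elim: n => // n IH; rewrite (leq_ltn_trans IH)// ha.
have below n : (k < a n)%N -> exists2 j, True & a j = k.
  elim: n => [|n IH]; first by rewrite ltnNge next_min.
  case: (ltngtP k (a n)) => [/IH//|ank|->]; last by exists n.
  by rewrite aS ltnNge next_min.
exact/(below k.+1)/a_ge.
Qed.

Lemma enum_incP A : infinite_set A -> increasing_enum_spec A (enum_inc A).
Proof. by move=> /increasing_enum_exists; exact: xgetPex. Qed.

Lemma enum_inc_ge A n : infinite_set A -> (n <= enum_inc A n)%N.
Proof.
move=> /enum_incP[ha _].
by elim: n => // n IH; rewrite (leq_ltn_trans IH)// ha.
Qed.

Lemma finite_rep_pairs A n : infinite_set A -> finite_set (rep_pairs A n).
Proof.
move=> infA; apply: (@sub_finite_set _ _ (`I_n.+1 `*` `I_n.+1)).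
  move=> [i j] /= [_ <-]; rewrite !ltnS.
  split; apply: leq_trans (enum_inc_ge _ infA) _.
    exact: leq_addr.
  exact: leq_addl.
exact: finite_setX.
Qed.

Lemma finite_nat_le (R : realType) (x : R) :
  finite_set [set n : nat | n%:R <= x].
Proof.
apply: (@sub_finite_set _ _ `I_(Num.truncn x).+1); last exact: finite_II.
move=> n /= nx; rewrite ltnNge; apply/negP => xn.
have := le_lt_trans nx (truncnS_gt x).
by rewrite ltr_nat ltnNge xn.
Qed.

Lemma finite_rep_values (R : realType) A (x : R) : finite_set (rep_values A x).
Proof. exact/finite_image/finite_nat_le. Qed.

Lemma finite_shifts (R : realType) A B (x : R) :
  infinite_set A -> infinite_set B -> finite_set (shifts A B x).
Proof.
move=> infA infB; apply: finite_image.
apply: sub_finite_set (finite_nat_le x) => t /= [] /(le_trans _); apply;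
by rewrite ler_nat enum_inc_ge.
Qed.

Lemma set_max_in S : finite_set S -> S !=set0 -> S (set_max S).
Proof.
move=> finS [k Sk]; rewrite /set_max.
have kS : k \in enum_fset (fset_set S).
  by rewrite -[_ \in _]/(k \in fset_set S) in_fset_set// inE.
have sub j : j \in enum_fset (fset_set S) -> S j.
  by rewrite -[_ \in _]/(j \in fset_set S) in_fset_set// inE.
have : (0 < size (enum_fset (fset_set S)))%N by case: enum_fset kS.
move: sub; elim: (enum_fset (fset_set S)) => // i s IH sub _.
rewrite big_cons; case: s IH sub => [|j s] IH sub.
  by rewrite big_nil maxn0; apply: sub; rewrite inE.
set m := \max_(_ <- _) _; have Sm : S m.
  by apply: IH => // l ls; apply: sub; rewrite inE ls orbT.
by case: (leqP i m) => _ //; apply: sub; rewrite inE eqxx.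
Qed.

Lemma set_max_ub S k : finite_set S -> S k -> (k <= set_max S)%N.
Proof.
move=> finS Sk; rewrite /set_max (bigD1_seq k) ?fset_uniq//= ?leq_maxl//.
by rewrite in_fset_set// inE.
Qed.

(* Main.v *)
Require Import Defs.
From mathcomp Require Import all_boot all_order all_algebra finmap.
From mathcomp Require Import all_classical all_reals all_analysis.
From mathcomp Require Import zify lra.
Import Order.TTheory GRing.Theory Num.Theory numFieldNormedType.Exports.

(** If b_i + b_j = n <= x, then both indices are counted in D = d_{A,B}(x), so
    a_i + a_j lies within 2 D of n.  Hence every representation of n by B is a
    representation, with the same indices, by A of one of the 4 D + 1 integers
    around n, and
      s_B(x) <= (4 D + 1) s_A(x + 2 D)
    ([rep_max_shift]).  When 0 <= beta <= 1, D is eventually at most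
    2 x^beta <= 2 x, so this reads s_B(x) <= 9 x^beta s_A(5 x)
    ([rep_max_compare]), and s_A(5 x) << x^alpha gives s_B(x) << x^(alpha +
    beta).  The roles of A and B can be exchanged because d_{A,B} is symmetric;
    then s_A(x / 5) << x^beta s_B(x) gives x^(alpha - beta) << s_B(x).

    The remaining cases follow from the trivial bounds 1 <= s_B(x) <= 2 x and
    from a priori bounds on the exponents, obtained by comparing powers of x
    ([powR_near_le]).  Since 1 <= s_A(x) <= 2 x eventually, 0 <= alpha <= 1.
    Since d_{A,B} is integer valued and eventually nonzero, it is eventually at
    least 1, so 0 <= beta.  In particular beta > 1 forces alpha - beta < 0 and
    alpha + beta > 1, and then the trivial bounds are what is claimed. *)

Set Implicit Arguments.
Unset Strict Implicit.

Local Open Scope classical_set_scope.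
Local Open Scope ring_scope.

(** * Counting representations *)

Lemma card_fset_set_cover {T : choiceType} (S : set T) (F : nat -> set T)
    (N M : nat) :
  (forall k, finite_set (F k)) -> S `<=` \bigcup_(k < N) F k ->
  (forall k, (k < N)%N -> (#|` fset_set (F k)| <= M)%N) ->
  (#|` fset_set S| <= N * M)%N.
Proof.
move=> finF; elim: N S => [|N IH] S SF FM.
  have -> : S = set0 by rewrite -subset0 => x /SF[].
  by rewrite fset_set0 cardfs0.
have finD : finite_set (S `\` F N).
  apply: (@sub_finite_set _ _ (\bigcup_(k < N.+1) F k)).
    by move=> x [/SF].
  by apply: bigcup_finite => //; exact: finite_II.
have finI : finite_set (S `&` F N) by apply: sub_finite_set (finF N) => x [].
rewrite -(setDUK (A := S `&` F N) (B := S)); last by move=> x [].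
have -> : S `\` (S `&` F N) = S `\` F N by rewrite setDIr setDv set0U.
rewrite fset_setU// (leq_trans (leq_card_fsetU _ _))// mulSn leq_add//.
  apply: leq_trans (FM N _); last exact: ltnSn.
  by apply: fsubset_leq_card; rewrite -fset_set_sub// => x [].
apply: IH => [x [Sx nFx]|k kN]; last by apply: FM; exact: ltnW.
have [k /=] := SF _ Sx; rewrite ltnS leq_eqVlt => /predU1P[-> //|kN Fkx].
by exists k.
Qed.

Lemma set_max_le (S : set nat) (m : nat) :
  finite_set S -> (forall k, S k -> (k <= m)%N) -> (set_max S <= m)%N.
Proof.
move=> finS Sm; rewrite /set_max big_seq; apply/bigmax_leqP_seq => k kS _.
by apply: Sm; move: kS; rewrite in_fset_set// inE.
Qed.

Lemma enum_inc_inj (A : set nat) : infinite_set A -> injective (enum_inc A).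
Proof.
move=> /enum_incP[ha _] i j e.
by case: (ltngtP i j) => // /ha; rewrite e ltnn.
Qed.

(** A representation is determined by its smaller index, which is at most the
    smaller summand. *)
Lemma rep_count_le (A : set nat) (n : nat) :
  infinite_set A -> (rep_count A n <= n.+1)%N.
Proof.
move=> infA; apply: geq_card_fset_set.
apply: (@card_le_trans _ _ _ [set p.1 | p in rep_pairs A n]).
  suff : ([set p.1 | p in rep_pairs A n] #= rep_pairs A n)%card.
    by rewrite card_eq_le => /andP[].
  apply: inj_card_eq => -[i j] [i' j'].
  rewrite !inE => -[/= _ e] [/= _ e'] ii; move: e e'; rewrite -ii => <-.
  by move=> /addnI /(enum_inc_inj infA) ->.
apply: subset_card_le => _ [[i j] [_ /= e] <-] /=.
by rewrite ltnS -e (leq_trans (enum_inc_ge i infA))// leq_addr.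
Qed.

(** A pair of indices representing n by B represents by A some m with
    |m - n| <= 2 D. *)
Lemma rep_count_shift (A B : set nat) (n D M : nat) :
  infinite_set A ->
  (forall t, (enum_inc B t <= n)%N ->
    (`|(enum_inc A t)%:Z - (enum_inc B t)%:Z| <= D)%N) ->
  (forall m, (m <= n + 2 * D)%N -> (rep_count A m <= M)%N) ->
  (rep_count B n <= (4 * D + 1) * M)%N.
Proof.
move=> infA hD hM; pose F k := rep_pairs A (n + 2 * D - k).
(* For k <= 4 D the values n + 2 D - k exhaust the integers at distance at most
   2 D from n; the truncation of the subtraction merely repeats 0. *)
apply: (@card_fset_set_cover _ _ F) => [k|[i j] [/= ij e]|k _].
- exact: finite_rep_pairs.
- have := hD i; have := hD j.
  rewrite -e leq_addl leq_addr => /(_ isT) Dj /(_ isT) Di.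
  exists (n + 2 * D - (enum_inc A i + enum_inc A j))%N => /=; first by lia.
  by split => //=; lia.
- by apply: hM; exact: leq_subr.
Qed.

(** * Maximal representation counts *)

Section counting.
Variable R : realType.
Implicit Types (A B : set nat) (x y : R).

Lemma rep_count_le_max A x (n : nat) :
  n%:R <= x -> (rep_count A n <= rep_max A x)%N.
Proof. by move=> nx; apply: set_max_ub; [exact: finite_rep_values|exists n]. Qed.

Lemma rep_max_mono A x y : x <= y -> (rep_max A x <= rep_max A y)%N.
Proof.
move=> xy; apply: set_max_le; first exact: finite_rep_values.
by move=> _ [n nx <-]; apply: rep_count_le_max; exact: le_trans xy.
Qed.

Lemma rep_max_le A x : infinite_set A -> 1 <= x ->
  (rep_max A x)%:R <= 2 * x.
Proof.
move=> infA x1; apply: (@le_trans _ _ (Num.truncn x).+1%:R).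
  rewrite ler_nat; apply: set_max_le; first exact: finite_rep_values.
  move=> _ [n /= nx <-]; apply: leq_trans (rep_count_le _ infA) _.
  by rewrite ltnS truncn_ge_nat//; lra.
by rewrite -natr1 mulr_natl mulr2n lerD// truncn_le; lra.
Qed.

(** The pair (0, 0) represents twice the least element of A. *)
Lemma rep_max_gt0 A : infinite_set A ->
  \forall x \near +oo, (0 < rep_max A (x : R))%N.
Proof.
move=> infA; pose n := (enum_inc A 0 + enum_inc A 0)%N.
have : (0 < rep_count A n)%N.
  rewrite cardfs_gt0; apply/fset0Pn; exists (0%N, 0%N).
  by rewrite in_fset_set ?inE//; exact: finite_rep_pairs.
move=> n0; near=> x; apply: leq_trans n0 _; apply: rep_count_le_max.
by near: x; exact: nbhs_pinfty_ge.
Unshelve. all: by end_near. Qed.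

Lemma enum_dist_sym A B x : enum_dist A B x = enum_dist B A x.
Proof.
rewrite /enum_dist; congr set_max; apply/seteqP.
by split=> _ [t [tx|tx] <-]; exists t; rewrite 1?distnC//=;
  [right|left|right|left].
Qed.

Lemma rep_max_shift A B x : infinite_set A -> infinite_set B ->
  (rep_max B x <= (4 * enum_dist A B x + 1)
    * rep_max A (x + 2 * (enum_dist A B x)%:R))%N.
Proof.
move=> infA infB; set D := enum_dist A B x.
apply: set_max_le; first exact: finite_rep_values.
move=> _ [n /= nx <-]; apply: (rep_count_shift (A := A)) => // [t tn|m mn].
  apply: set_max_ub; first exact: finite_shifts.
  by exists t => //; right; apply: le_trans nx; rewrite ler_nat.
apply: rep_count_le_max; apply: (@le_trans _ _ (n + 2 * D)%:R).
  by rewrite ler_nat.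
by rewrite natrD natrM lerD2r.
Qed.

End counting.

(** * Asymptotic comparison *)

Section asymptotics.
Variable R : realType.
Implicit Types (A B : set nat) (a b : R).

Lemma cvg_ratio1_bounds (f : R -> R) a :
  f x / x `^ a @[x --> +oo] --> (1 : R) ->
  \forall x \near +oo, x `^ a <= 2 * f x /\ f x <= 2 * x `^ a.
Proof.
move=> fa; near=> x.
have xa : 0 < x `^ a.
  by apply: powR_gt0; near: x; exact: nbhs_pinfty_gt.
have : f x / x `^ a <= 2.
  by near: x; apply: (cvgr_le _ fa); rewrite ltr1n.
have : 2^-1 <= f x / x `^ a.
  by near: x; apply: (cvgr_ge _ fa); rewrite invf_lt1// ltr1n.
rewrite ler_pdivrMr// ler_pdivlMr// => h1 h2; split => //.
by lra.
Unshelve. all: by end_near. Qed.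

(** Converts eventual bounds into inequalities between exponents: a power with
    positive exponent is unbounded. *)
Lemma powR_near_le a b (C : R) :
  (\forall x \near +oo, x `^ a <= C * x `^ b) -> a <= b.
Proof.
move=> h; rewrite leNgt; apply/negP => ba.
have ab0 : 0 < a - b by rewrite subr_gt0.
near (pinfty_nbhs R) => x.
have x0 : 0 < x by near: x; exact: nbhs_pinfty_gt.
have : x `^ (a - b) <= C.
  rewrite powRB ?(gt_eqF x0) ?implybT// ler_pdivrMr ?powR_gt0//.
  by near: x.
have : `|C| + 1 <= x `^ (a - b).
  have -> : `|C| + 1 = ((`|C| + 1) `^ (a - b)^-1) `^ (a - b).
    by rewrite -powRrM mulVf ?gt_eqF// powRr1// addr_ge0.
  apply: ge0_ler_powR.
  - exact: ltW.
  - by rewrite nnegrE powR_ge0.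
  - by rewrite nnegrE ltW.
  - by near: x; apply: nbhs_pinfty_ge; exact: num_real.
by have := ler_norm C; lra.
Unshelve. all: by end_near. Qed.

(** The hypothesis [b <= 1] keeps the shifted argument x + 2 D below 5 x, and
    [0 <= b] lets x^b absorb the 1 in 4 D + 1 <= 8 x^b + 1. *)
Lemma rep_max_compare A B b : infinite_set A -> infinite_set B ->
  0 <= b -> b <= 1 ->
  (\forall x \near +oo, (enum_dist A B x)%:R <= 2 * (x : R) `^ b) ->
  \forall x \near +oo,
    (rep_max B (x : R))%:R <= 9 * x `^ b * (rep_max A (5 * x))%:R.
Proof.
move=> infA infB b0 b1 hD; near=> x.
have x1 : 1 <= x by near: x; exact: nbhs_pinfty_ge.
have xb1 : 1 <= x `^ b by rewrite -(powRr0 x) ler_powR.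
have xbx : x `^ b <= x by exact: ler1_powR.
have Dx : (enum_dist A B x)%:R <= 2 * x `^ b by near: x.
apply: (@le_trans _ _ ((4 * enum_dist A B x + 1)
    * rep_max A (x + 2 * (enum_dist A B x)%:R))%:R).
  by rewrite ler_nat rep_max_shift.
rewrite natrM ler_pM//; first by rewrite natrD natrM; lra.
by rewrite ler_nat; apply: rep_max_mono; lra.
Unshelve. all: by end_near. Qed.

Lemma near_pinfty_scale (c : R) (P : R -> Prop) : 0 < c ->
  (\forall x \near +oo, P x) -> \forall x \near +oo, P (c * x).
Proof.
move=> c0 [M [Mr PM]]; exists (M / c); split; first by rewrite num_real.
by move=> x Mx; apply: PM; rewrite mulrC -ltr_pdivrMr.
Qed.

End asymptotics.

Unset Implicit Arguments.
Set Strict Implicit.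

Theorem corollary2 (R : realType) (A B : set nat) (alpha beta : R)
  (infA : infinite_set A) (infB : infinite_set B)
  (hs : (rep_max A x)%:R / x `^ alpha @[x --> +oo] --> (1 : R))
  (hd : (enum_dist A B x)%:R / x `^ beta @[x --> +oo] --> (1 : R)) :
  ((fun x : R => x `^ Num.max 0 (alpha - beta))
     =O_ (pinfty_nbhs R) (fun x : R => (rep_max B x)%:R : R)) /\
  ((fun x : R => (rep_max B x)%:R : R)
     =O_ (pinfty_nbhs R) (fun x : R => x `^ Num.min (alpha + beta) 1)).
Proof.
have sA := cvg_ratio1_bounds hs; have dAB := cvg_ratio1_bounds hd.
have sA1 := rep_max_gt0 R infA; have sB1 := rep_max_gt0 R infB.
have alpha_ge0 : 0 <= alpha.
  apply: (@powR_near_le _ _ _ 2); near=> x.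
  rewrite powRr0; apply: (@le_trans _ _ (rep_max A x)%:R).
    by rewrite ler1n; near: x.
  by near: x; apply: filterS sA => x [].
have alpha_le1 : alpha <= 1.
  apply: (@powR_near_le _ _ _ 4); near=> x.
  have x1 : 1 <= x by near: x; exact: nbhs_pinfty_ge.
  have : x `^ alpha <= 2 * (rep_max A x)%:R.
    by near: x; apply: filterS sA => x [].
  by have := rep_max_le infA x1; rewrite powRr1; lra.
have beta_ge0 : 0 <= beta.
  apply: (@powR_near_le _ _ _ 2); near=> x.
  have x0 : 0 < x by near: x; exact: nbhs_pinfty_gt.
  have [lo hi] : x `^ beta <= 2 * (enum_dist A B x)%:R /\
      (enum_dist A B x)%:R <= 2 * x `^ beta by near: x.
  (* The lower bound excludes the value 0, and the distance is an integer. *)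
  rewrite powRr0; apply: le_trans hi; rewrite ler1n lt0n; apply/eqP => D0.
  by move: lo; rewrite D0 mulr0 leNgt powR_gt0.
split; apply/eqO_pinftyP.
- have [ab|ba] := leP alpha beta.
    rewrite max_l ?subr_le0//; exists 1 => //; near=> x.
    by rewrite powRr0 normr1 mul1r normr_nat ler1n; near: x.
  (* Here beta < alpha <= 1, so the comparison applies with A and B exchanged. *)
  rewrite max_r ?subr_ge0 1?ltW//.
  have beta_le1 : beta <= 1 by lra.
  exists (18 * 5 `^ (alpha - beta)); first by rewrite mulr_gt0// powR_gt0.
  have cmp : \forall x \near +oo,
      (rep_max A (x : R))%:R <= 9 * x `^ beta * (rep_max B (5 * x))%:R.
    apply: rep_max_compare => //; apply: filterS dAB => x [_].
    by rewrite enum_dist_sym.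
  have step : \forall x \near +oo,
      x `^ (alpha - beta) <= 18 * (rep_max B (5 * x))%:R.
    near=> x; have x0 : 0 < x by near: x; exact: nbhs_pinfty_gt.
    rewrite powRB ?(gt_eqF x0) ?implybT// ler_pdivrMr ?powR_gt0//.
    have : x `^ alpha <= 2 * (rep_max A x)%:R.
      by near: x; apply: filterS sA => x [].
    have : (rep_max A (x : R))%:R <= 9 * x `^ beta * (rep_max B (5 * x))%:R.
      by near: x.
    by lra.
  near=> x; have x0 : 0 < x by near: x; exact: nbhs_pinfty_gt.
  have : (5^-1 * x) `^ (alpha - beta)
      <= 18 * (rep_max B (5 * (5^-1 * x)))%:R.
    by near: x; apply: near_pinfty_scale step; rewrite invr_gt0.
  rewrite mulVKf// normr_nat ger0_norm ?powR_ge0// => le5.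
  have {1}-> : x = 5 * (5^-1 * x) by rewrite mulVKf.
  rewrite powRM// ?mulr_ge0 ?invr_ge0 ?(ltW x0)//.
  by rewrite [18 * 5 `^ _]mulrC -mulrA ler_wpM2l ?powR_ge0.
- have [ab|ba] := leP 1 (alpha + beta).
    exists 2 => //; near=> x.
    have x1 : 1 <= x by near: x; exact: nbhs_pinfty_ge.
    rewrite normr_nat powRr1 ?ger0_norm; [exact: rep_max_le|lra..].
  (* Here beta <= alpha + beta < 1. *)
  have beta_le1 : beta <= 1 by lra.
  have cmp : \forall x \near +oo,
      (rep_max B (x : R))%:R <= 9 * x `^ beta * (rep_max A (5 * x))%:R.
    by apply: rep_max_compare => //; apply: filterS dAB => x [].
  exists (18 * 5 `^ alpha); first by rewrite mulr_gt0// powR_gt0.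
  near=> x; have x0 : 0 < x by near: x; exact: nbhs_pinfty_gt.
  have sB : (rep_max B x)%:R <= 9 * x `^ beta * (rep_max A (5 * x))%:R.
    by near: x.
  have sA5 : (rep_max A (5 * x))%:R <= 2 * (5 * x) `^ alpha.
    near: x.
    apply: (@near_pinfty_scale R 5 (fun y =>
      (rep_max A y)%:R <= 2 * y `^ alpha)) => //.
    by apply: filterS sA => y [].
  rewrite normr_nat ger0_norm ?powR_ge0//; apply: le_trans sB _.
  apply: (@le_trans _ _ (9 * x `^ beta * (2 * (5 * x) `^ alpha))).
    by rewrite ler_wpM2l// mulr_ge0// powR_ge0.
  rewrite powRM ?(ltW x0)// powRD ?(gt_eqF x0) ?implybT//.
  by lra.
Unshelve. all: by end_near. Qed.
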